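(* Let $0<a<1$ and $b>1$ be such that $ab > 1+\frac{3}{2}\pi$. Let $n \geq 1$ be a fixed integer and let $M > 0$ be such that $M < n\pi$. For $N\in\mathbb{N}$ and $x \in \mathbb{R}$ set $$\mathcal{W}_{N, n}(x) = \sum_{m=0}^{N} a^m \left[ \cos\left(\frac{x}{n}\right) + i \alpha_m \sin\left(\frac{x}{n}\right) \right]^n, \qquad \alpha_m = b^m \pi .$$ Then the infinite series $\lim_{N \to \infty} \mathcal{W}_{N, n}(x)$ behaves as follows: (1) for $x = 0$, the series converges absolutely to $\frac{1}{1-a}$; (2) for any $x \in [-M, M] \setminus \{0\}$, the series diverges.
   Context: ''The series'' at $x$ is the series of complex numbers $\sum_{m=0}^{\infty} a^m \left[ \cos(x/n) + i b^m\pi \sin(x/n) \right]^n$, whose partial sums are $\mathcal{W}_{N,n}(x)$; it diverges if the sequence of partial sums has no limit in $\mathbb{C}$. *)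

(* Defs.v *)
From Stdlib Require Export Reals.
From Coquelicot Require Export Coquelicot.

Open Scope R_scope.

Definition alpha (b : R) (m : nat) : R := b ^ m * PI.

Definition term (a b : R) (n : nat) (x : R) (m : nat) : C :=
  (RtoC (a ^ m)
   * (RtoC (cos (x / INR n)) + Ci * RtoC (alpha b m) * RtoC (sin (x / INR n))) ^ n)%C.

(* [sum_n u N] has N + 1 summands: u 0 + ... + u N. *)
Definition W (a b : R) (N n : nat) (x : R) : C :=
  sum_n (term a b n x) N.

Definition series_converges_to (a b : R) (n : nat) (x : R) (l : C) : Prop :=
  filterlim (fun N : nat => W a b N n x) eventually (locally l).

Definition series_converges_absolutely (a b : R) (n : nat) (x : R) : Prop :=
  ex_series (fun m : nat => Cmod (term a b n x m)).

Definition series_diverges (a b : R) (n : nat) (x : R) : Prop :=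
  ~ exists l : C, series_converges_to a b n x l.

(* Main.v *)
Require Import Defs.
From Stdlib Require Import Reals Lra Lia.
From Coquelicot Require Import Coquelicot.
Open Scope R_scope.

(** Divergence away from the origin has an elementary cause: the summands do
    not tend to zero.  The imaginary part of the bracket is
    [alpha b m * sin (x / n)], so the [m]-th summand has modulus at least
    [a^m * (b^m * PI * |sin (x / n)|)^n].  Since [b > 1] and [n >= 1], raising
    [b^m] to the power [n] can only enlarge it, whence
    [a^m * (b^m)^n >= (a * b)^m >= 1], and the modulus is bounded below by
    [(PI * |sin (x / n)|)^n] ([Cmod_term_ge]).  This constant is positive as
    soon as [0 < |x / n| < PI] ([sin_neq_0_of_lt_PI]), so the Cauchy criterion
    fails ([Cmod_small_of_cvg_sum_n]).

    At the origin every bracket equals [1] and the series is the geometric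
    series of ratio [a]. *)

Lemma term_0 (a b : R) (n m : nat) : term a b n 0 m = RtoC (a ^ m).
Proof.
unfold term.
replace (0 / INR n) with 0 by (unfold Rdiv; ring).
rewrite cos_0, sin_0, Cmult_0_r, Cplus_0_r, Cpow_1_l, Cmult_1_r.
reflexivity.
Qed.

Lemma sum_n_RtoC (u : nat -> R) (N : nat) :
  sum_n (fun m => RtoC (u m)) N = RtoC (sum_n u N).
Proof.
induction N as [|N IH].
- rewrite !sum_O; reflexivity.
- rewrite !sum_Sn, IH. symmetry; apply RtoC_plus.
Qed.

Lemma filterlim_RtoC (l : R) : filterlim RtoC (locally l) (locally (RtoC l)).
Proof.
apply filterlim_locally; intros eps.
exists eps; intros y Hy; split; [exact Hy | apply ball_center].
Qed.

Lemma Cmod_small_of_cvg_sum_n (u : nat -> C) (l : C) :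
  filterlim (fun N => sum_n u N) eventually (locally l) ->
  forall eps : posreal,
    exists N, forall m, (N <= m)%nat -> Cmod (u m) < eps.
Proof.
intros Hl eps.
(* The Cauchy criterion is applied to blocks consisting of one summand. *)
destruct (@Cauchy_ex_series R_AbsRing C_R_CompleteNormedModule u
            (ex_intro _ l Hl) eps) as [N HN].
exists N; intros m Hm.
specialize (HN m m Hm Hm).
rewrite sum_n_n in HN.
rewrite Cmod_norm; exact HN.
Qed.

Lemma sin_neq_0_of_lt_PI (y : R) : - PI < y < PI -> y <> 0 -> sin y <> 0.
Proof.
intros [Hl Hu] Hy.
destruct (Rlt_or_le 0 y) as [Hpos | Hneg].
- pose proof (sin_gt_0 y Hpos Hu); lra.
- pose proof (sin_gt_0 (- y) ltac:(lra) ltac:(lra)) as H.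
  rewrite sin_neg in H; lra.
Qed.

Lemma Cmod_bracket_ge (b y : R) (m : nat) : 0 < b ->
  b ^ m * (PI * Rabs (sin y))
    <= Cmod (RtoC (cos y) + Ci * RtoC (alpha b m) * RtoC (sin y)).
Proof.
intros Hb.
eapply Rle_trans; [| apply Rmax_Cmod].
eapply Rle_trans; [| apply Rmax_r].
apply Req_le; simpl.
replace (_ + _) with (b ^ m * PI * sin y) by (unfold alpha; ring).
pose proof (pow_lt b m Hb); pose proof PI_RGT_0.
rewrite !Rabs_mult, (Rabs_pos_eq (b ^ m)), (Rabs_pos_eq PI) by lra.
ring.
Qed.

(** The growth of [b^m] compensates the decay of [a^m] already at the first
    power, so the bound does not depend on [m]. *)
Lemma Cmod_term_ge (a b x : R) (n m : nat) :
  0 < a -> 1 <= b -> 1 <= a * b -> (1 <= n)%nat ->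
  (PI * Rabs (sin (x / INR n))) ^ n <= Cmod (term a b n x m).
Proof.
intros Ha Hb Hab Hn.
set (s := PI * Rabs (sin (x / INR n))).
assert (Hs : 0 <= s).
{ apply Rmult_le_pos; [left; apply PI_RGT_0 | apply Rabs_pos]. }
pose proof (pow_lt a m Ha) as Ham.
pose proof (pow_R1_Rle b m Hb) as Hbm.
unfold term.
rewrite Cmod_mult, Cmod_R, Cmod_pow, (Rabs_pos_eq (a ^ m)) by lra.
apply Rle_trans with (a ^ m * (b ^ m * s) ^ n).
- rewrite Rpow_mult_distr, <- Rmult_assoc.
  rewrite <- (Rmult_1_l (s ^ n)) at 1.
  apply Rmult_le_compat_r; [now apply pow_le |].
  apply Rle_trans with (a ^ m * b ^ m).
  + rewrite <- Rpow_mult_distr; now apply pow_R1_Rle.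
  + apply Rmult_le_compat_l; [lra |].
    rewrite <- (pow_1 (b ^ m)) at 1; now apply Rle_pow.
- apply Rmult_le_compat_l; [lra |].
  apply pow_incr; split.
  + apply Rmult_le_pos; lra.
  + apply Cmod_bracket_ge; lra.
Qed.

Theorem theorem3p1 :
  forall a b : R, 0 < a < 1 -> 1 < b -> a * b > 1 + 3 / 2 * PI ->
  forall n : nat, (1 <= n)%nat ->
  forall M : R, 0 < M -> M < INR n * PI ->
    (series_converges_absolutely a b n 0 /\
     series_converges_to a b n 0 (RtoC (1 / (1 - a)))) /\
    (forall x : R, - M <= x <= M -> x <> 0 -> series_diverges a b n x).
Proof.
intros a b [Ha Ha1] Hb Hab n Hn M HM HMn.
assert (Habs : Rabs a < 1) by (rewrite Rabs_pos_eq; lra).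
split; [split |].
- apply ex_series_ext with (fun m => a ^ m); [| now apply ex_series_geom].
  intros m.
  rewrite term_0, Cmod_R, Rabs_pos_eq; [reflexivity | apply pow_le; lra].
- unfold series_converges_to, W.
  apply filterlim_ext with (fun N => RtoC (sum_n (fun m => a ^ m) N)).
  { intros N; rewrite <- sum_n_RtoC.
    apply sum_n_ext; intros m; now rewrite term_0. }
  replace (1 / (1 - a)) with (/ (1 - a)) by (unfold Rdiv; ring).
  eapply filterlim_comp; [exact (is_series_geom a Habs) |].
  apply filterlim_RtoC.
- intros x Hx Hx0 [l Hl].
  assert (Hn0 : 0 < INR n) by (apply lt_0_INR; lia).
  assert (Hsin : sin (x / INR n) <> 0).
  { apply sin_neq_0_of_lt_PI.
    - split; [apply Rlt_div_r | apply Rlt_div_l]; lra.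
    - intros H; apply Hx0.
      replace x with (x / INR n * INR n) by (field; lra).
      rewrite H; ring. }
  pose proof PI_RGT_0 as HPI.
  assert (Hs : 0 < (PI * Rabs (sin (x / INR n))) ^ n).
  { apply pow_lt, Rmult_lt_0_compat; [exact HPI | now apply Rabs_pos_lt]. }
  destruct (Cmod_small_of_cvg_sum_n _ _ Hl (mkposreal _ Hs)) as [N HN].
  specialize (HN N (Nat.le_refl N)); simpl in HN.
  pose proof (Cmod_term_ge a b x n N Ha ltac:(lra) ltac:(lra) Hn).
  lra.
Qed.
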